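(* Let $m\ge 2$, let $\sigma_1$ and $\sigma_2$ be two permutations of $\mathbb{F}_2^m$, and assume that the mapping $\sigma_1+\sigma_2\colon\mathbb{F}_2^m\to\mathbb{F}_2^m$ satisfies the property $(P_2)$. Define $\pi\colon\mathbb{F}_2^{m+1}\to\mathbb{F}_2^{m+1}$ by $$\pi(y,y_{m+1})=\left(\sigma_1(y)+y_{m+1}(\sigma_1(y)+\sigma_2(y)),\ y_{m+1}\right),\quad y\in\mathbb{F}_2^m,\ y_{m+1}\in\mathbb{F}_2.$$ Then $\pi$ is a permutation of $\mathbb{F}_2^{m+1}$ that satisfies the property $(P_2)$.
   Context: For $F\colon\mathbb{F}_2^r\to\mathbb{F}_2^r$ and $a,b\in\mathbb{F}_2^r$: $D_aF(y)=F(y+a)+F(y)$ and $D_aD_bF(y)=F(y+a+b)+F(y+a)+F(y+b)+F(y)$. $0_r$ denotes the zero vector; $D_aD_bF=0_r$ means the function is identically $0_r$. $v\cdot w=\sum_i v_iw_i$ is the standard scalar product over $\mathbb{F}_2$. Property $(P_2)$ for a mapping $F\colon\mathbb{F}_2^r\to\mathbb{F}_2^r$ (not necessarily a permutation): for a subspace $S$ of $\mathbb{F}_2^r$ with $1\le\dim(S)\le r-1$ such that $D_aD_bF=0_r$ for all $a,b\in S$, $F$ satisfies $(P_2)$ with respect to $S$ if there does not exist a linear subspace $V$ of $\mathbb{F}_2^r$ with $\dim(V)=r-\dim(S)$ such that $v\cdot D_aF(y)=0$ for all $a\in S$, all $y\in\mathbb{F}_2^r$ and all $v\in V$. If $F$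 satisfies $(P_2)$ with respect to every subspace $S$ with $1\le\dim(S)\le r-1$ such that $D_aD_bF=0_r$ for all $a,b\in S$, then $F$ is said to satisfy $(P_2)$. *)

(* Defs.v *)
From mathcomp Require Import all_boot all_order all_algebra.

Set Implicit Arguments.
Unset Strict Implicit.
Unset Printing Implicit Defensive.

Import GRing.Theory.
Local Open Scope ring_scope.

Definition dotp (r : nat) (v w : 'rV['F_2]_r) : 'F_2 := \sum_(i < r) v 0 i * w 0 i.

Definition D1 (r : nat) (a : 'rV['F_2]_r) (F : 'rV['F_2]_r -> 'rV['F_2]_r) (y : 'rV['F_2]_r) :
  'rV['F_2]_r := F (y + a) + F y.

Definition D2 (r : nat) (a b : 'rV['F_2]_r) (F : 'rV['F_2]_r -> 'rV['F_2]_r) (y : 'rV['F_2]_r) :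
  'rV['F_2]_r := F (y + a + b) + F (y + a) + F (y + b) + F y.

Definition P2_admissible (r : nat) (F : 'rV['F_2]_r -> 'rV['F_2]_r)
    (S : {vspace 'rV['F_2]_r}) : Prop :=
  (1 <= \dim S <= r - 1)%N /\
  (forall a b : 'rV['F_2]_r, a \in S -> b \in S -> forall y, D2 a b F y = 0).

Definition P2_wrt (r : nat) (F : 'rV['F_2]_r -> 'rV['F_2]_r)
    (S : {vspace 'rV['F_2]_r}) : Prop :=
  ~ exists V : {vspace 'rV['F_2]_r},
      \dim V = (r - \dim S)%N /\
      (forall a y v : 'rV['F_2]_r, a \in S -> v \in V -> dotp v (D1 a F y) = 0).

Definition P2 (r : nat) (F : 'rV['F_2]_r -> 'rV['F_2]_r) : Prop :=
  forall S : {vspace 'rV['F_2]_r}, P2_admissible F S -> P2_wrt F S.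

(* A vector of F_2^(m+1) is the block row (y, y_{m+1}): [lsubmx z] is y and
   [rsubmx z] is the 1 x 1 block holding the last coordinate. *)
Definition pi_map (m : nat) (sigma1 sigma2 : 'rV['F_2]_m -> 'rV['F_2]_m)
    (z : 'rV['F_2]_(m + 1)) : 'rV['F_2]_(m + 1) :=
  let y : 'rV['F_2]_m := lsubmx z in
  let t : 'F_2 := rsubmx z 0 0 in
  row_mx (sigma1 y + t *: (sigma1 y + sigma2 y)) t%:M.

(* Main.v *)
Require Import Defs.
From mathcomp Require Import all_boot all_order all_algebra.
Import GRing.Theory.
Local Open Scope ring_scope.

(** Restricted to the two hyperplanes [t = 0] and [t = 1], the map [pi] is
    [sigma1] and [sigma2] respectively.  Gluing the inverses of [sigma1] and
    [sigma2] in the same way therefore gives the inverse of [pi].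

    For (P2), write [G = sigma1 + sigma2] and suppose that [S] and [V] violate
    (P2) for [pi].  Let [S0] be the slice of [S] at last coordinate 0 and let
    [V'] be the projection of [V] that forgets the last coordinate.  Comparing
    the derivatives of [pi] on the two hyperplanes shows that the second
    derivatives of [G] along [S0] vanish and that [V'] is orthogonal to all
    [D_a G] with [a] in [S0].  Moreover [dim S0 + dim V' >= m]: slicing and
    projecting can each cost one dimension, but never both.  Indeed, if slicing
    loses a dimension then [S] has an element [(a, 1)]; the last coordinate of
    every [D_(a,1) pi] is 1, so that [(0, 1)] is not in [V] and the projection
    is injective on [V].  Hence [S0] and [V'] violate (P2) for [G], unless [S0]
    is trivial or the whole space.

    In these two extreme cases [D_b G] is constant for some [b <> 0], and this
    already contradicts (P2) for [G] ([P2_derivative_nonconstant]): take the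
    line spanned by [b] and the hyperplane orthogonal to the constant.  When
    [S0] is the whole space, [G] is affine.  When [S0] is trivial, [S] is
    spanned by some [(a, 1)] and [V'] is everything, so that
    [sigma2 (y + a) + sigma1 y] is constant in [y]; then [D_a G = 0], and [G]
    itself is constant if [a = 0]. *)

(** * Scalar products and characteristic 2 *)

Lemma F2_cases (t : 'F_2) : t = 0 \/ t = 1.
Proof. by case: t => [[|[|//]] ?]; [left | right]; apply: val_inj. Qed.

Lemma addF2 (t : 'F_2) : t + t = 0.
Proof. by case: (F2_cases t) => ->; apply: val_inj. Qed.

Lemma addvv n (x : 'rV['F_2]_n) : x + x = 0.
Proof. by apply/rowP => i; rewrite !mxE addF2. Qed.

Lemma addv_eq0 n (x y : 'rV['F_2]_n) : x + y = 0 -> x = y.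
Proof. by move=> h; rewrite -[LHS]addr0 -(addvv _ y) addrA h add0r. Qed.

Lemma dotp_mulmx r (v w : 'rV['F_2]_r) : dotp v w = (v *m w^T) 0 0.
Proof. by rewrite !mxE; apply: eq_bigr => i _; rewrite mxE. Qed.

Lemma dotpDr r (v x y : 'rV['F_2]_r) : dotp v (x + y) = dotp v x + dotp v y.
Proof. by rewrite !dotp_mulmx linearD /= mulmxDr mxE. Qed.

Lemma dotp_row_mx m n (v : 'rV['F_2]_(m + n)) (x : 'rV['F_2]_m) (z : 'rV['F_2]_n) :
  dotp v (row_mx x z) = dotp (lsubmx v) x + dotp (rsubmx v) z.
Proof. by rewrite !dotp_mulmx tr_row_mx -{1}[v]hsubmxK mul_row_col mxE. Qed.

Lemma dotp_row_mx0 m n (v : 'rV['F_2]_(m + n)) (x : 'rV['F_2]_m) :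
  dotp v (row_mx x 0) = dotp (lsubmx v) x.
Proof. by rewrite dotp_row_mx [X in _ + X]dotp_mulmx trmx0 mulmx0 mxE addr0. Qed.

Lemma dotp_nondegenerate r (x : 'rV['F_2]_r) :
  (forall v, dotp v x = 0) -> x = 0.
Proof.
move=> h; apply/rowP => i; rewrite mxE -(h (delta_mx 0 i)).
by rewrite dotp_mulmx -rowE !mxE.
Qed.

(** * Subspaces *)

Lemma subspace_of_dim (K : fieldType) (vT : vectType K) (W : {vspace vT}) k :
  (k <= \dim W)%N -> exists2 U : {vspace vT}, (U <= W)%VS & \dim U = k.
Proof.
move=> lekW; exists <<take k (vbasis W)>>%VS.
  rewrite -[X in (_ <= X)%VS](span_basis (vbasisP W)).
  by apply: sub_span => x /mem_take.
have := basis_free (vbasisP W); rewrite -{1}(cat_take_drop k (vbasis W)).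
by move/catl_free; rewrite /free => /eqP ->; rewrite size_takel // size_tuple.
Qed.

Lemma dim_rV (K : fieldType) n : \dim {:'rV[K]_n} = n.
Proof. by rewrite dimvf /dim /= mul1n. Qed.

Lemma dim_limg1 (vT : vectType 'F_2) (f : 'Hom(vT, 'rV['F_2]_1)) (U : {vspace vT}) :
  (\dim (f @: U) <= 1)%N.
Proof. by rewrite -[X in (_ <= X)%N](dim_rV 'F_2 1) dimvS ?subvf. Qed.

(** * Consequences of the property (P2) *)

(** (P2) excludes subspaces of dimension exactly [r - dim S], but a larger [V]
    contains one of these. *)
Lemma P2_dim_lt r (F : 'rV['F_2]_r -> 'rV['F_2]_r) (S V : {vspace 'rV['F_2]_r}) :
    P2 F -> P2_admissible F S ->
    (forall a y v, a \in S -> v \in V -> dotp v (D1 a F y) = 0) ->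
  (\dim V < r - \dim S)%N.
Proof.
move=> hF hS hV; rewrite ltnNge; apply/negP => /subspace_of_dim [U sUV dimU].
by case: (hF S hS); exists U; split=> // a y v aS /(subvP sUV); apply: hV.
Qed.

(** [D_b D_b F = 0] for every [F], so the line spanned by [b] is always
    admissible; a constant derivative [c] along it would make the hyperplane
    [v . c = 0], which has at least the forbidden dimension [r - 1], violate (P2). *)
Lemma P2_derivative_nonconstant r (F : 'rV['F_2]_r -> 'rV['F_2]_r) (b c : 'rV['F_2]_r) :
  (2 <= r)%N -> P2 F -> b != 0 -> ~ (forall y, D1 b F y = c).
Proof.
move=> r2 hF b0 hc; pose f := linfun (mulmxr c^T : 'rV['F_2]_r -> 'rV['F_2]_1).
have inline a : a \in <[b]>%VS -> a = 0 \/ a = b.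
  by case/vlineP => k ->; case: (F2_cases k) => ->; rewrite ?scale0r ?scale1r; auto.
have: (\dim (lker f) < r - \dim <[b]>)%N.
  apply: (P2_dim_lt _ _ _ _ hF).
  - split; first by rewrite dim_vline b0 /=; rewrite subn_gt0.
    move=> a a' /inline ha /inline ha' y; rewrite /D2.
    case: ha => ->; last case: ha' => ->.
    + by rewrite addr0 -addrA addvv.
    + by rewrite !addr0 addvv add0r addvv.
    + rewrite -[y + b + b]addrA addvv addr0 -[F y + _ + _]addrA addvv.
      by rewrite addr0 addvv.
  - move=> a y v /inline [] -> hv.
      by rewrite /D1 addr0 addvv dotp_mulmx trmx0 mulmx0 mxE.
    move: hv; rewrite hc dotp_mulmx memv_ker lfunE /= => /eqP ->.
    by rewrite mxE.
have := limg_ker_dim f fullv; rewrite capfv dim_rV dim_vline b0 /= => hd.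
by rewrite ltnNge leq_subLR addnC -[X in (X <= _)%N]hd leq_add2l dim_limg1.
Qed.

(** * The glued map *)

Local Notation e1 := (1%:M : 'rV['F_2]_1).

Lemma row_mx_cases m (z : 'rV['F_2]_(m + 1)) :
  z = row_mx (lsubmx z) 0 \/ z = row_mx (lsubmx z) e1.
Proof.
rewrite -{1 3}[z]hsubmxK [rsubmx z]mx11_scalar.
by case: (F2_cases (rsubmx z 0 0)) => ->; [left; rewrite raddf0 | right].
Qed.

Lemma pi_map0 m (s1 s2 : 'rV['F_2]_m -> 'rV['F_2]_m) y :
  pi_map s1 s2 (row_mx y 0) = row_mx (s1 y) 0.
Proof. by rewrite /pi_map row_mxKl row_mxKr mxE scale0r addr0 raddf0. Qed.

Lemma pi_map1 m (s1 s2 : 'rV['F_2]_m -> 'rV['F_2]_m) y :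
  pi_map s1 s2 (row_mx y e1) = row_mx (s2 y) e1.
Proof. by rewrite /pi_map row_mxKl row_mxKr mxE eqxx scale1r addrA addvv add0r. Qed.

Lemma pi_map_cancel m (s1 s2 t1 t2 : 'rV['F_2]_m -> 'rV['F_2]_m) :
  cancel s1 t1 -> cancel s2 t2 -> cancel (pi_map s1 s2) (pi_map t1 t2).
Proof.
move=> h1 h2 z; case: (row_mx_cases _ z) => ->.
  by rewrite !pi_map0 h1.
by rewrite !pi_map1 h2.
Qed.

Lemma pi_map_bijective m (s1 s2 : 'rV['F_2]_m -> 'rV['F_2]_m) :
  bijective s1 -> bijective s2 -> bijective (pi_map s1 s2).
Proof.
by case=> t1 h1 k1 [t2 h2 k2]; exists (pi_map t1 t2); apply: pi_map_cancel.
Qed.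

Lemma add_row_mx0 m (x a : 'rV['F_2]_m) (u : 'rV['F_2]_1) :
  row_mx x u + row_mx a 0 = row_mx (x + a) u.
Proof. by rewrite add_row_mx addr0. Qed.

Lemma D1_pi_map0 m (s1 s2 : 'rV['F_2]_m -> 'rV['F_2]_m) a y :
  D1 (row_mx a 0) (pi_map s1 s2) (row_mx y 0) = row_mx (D1 a s1 y) 0.
Proof. by rewrite /D1 add_row_mx0 !pi_map0 add_row_mx0. Qed.

Lemma D1_pi_map1 m (s1 s2 : 'rV['F_2]_m -> 'rV['F_2]_m) a y :
  D1 (row_mx a 0) (pi_map s1 s2) (row_mx y e1) = row_mx (D1 a s2 y) 0.
Proof. by rewrite /D1 add_row_mx0 !pi_map1 add_row_mx addvv. Qed.

(** A step that changes the last coordinate goes from one hyperplane to the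
    other, hence the difference of [s2] and [s1]. *)
Lemma D1_pi_map_cross m (s1 s2 : 'rV['F_2]_m -> 'rV['F_2]_m) a y :
  D1 (row_mx a e1) (pi_map s1 s2) (row_mx y 0) = row_mx (s2 (y + a) + s1 y) e1.
Proof. by rewrite /D1 [row_mx y 0 + _]add_row_mx add0r pi_map1 pi_map0 add_row_mx0. Qed.

Lemma D2_pi_map0 m (s1 s2 : 'rV['F_2]_m -> 'rV['F_2]_m) a b y :
  D2 (row_mx a 0) (row_mx b 0) (pi_map s1 s2) (row_mx y 0) = row_mx (D2 a b s1 y) 0.
Proof. by rewrite /D2 !add_row_mx0 !pi_map0 !add_row_mx0. Qed.

Lemma D2_pi_map1 m (s1 s2 : 'rV['F_2]_m -> 'rV['F_2]_m) a b y :
  D2 (row_mx a 0) (row_mx b 0) (pi_map s1 s2) (row_mx y e1) = row_mx (D2 a b s2 y) 0.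
Proof.
rewrite /D2 !add_row_mx0 !pi_map1 !add_row_mx.
by rewrite -[X in row_mx _ X]addrA addvv addr0.
Qed.

Lemma D1_add r (F H : 'rV['F_2]_r -> 'rV['F_2]_r) a y :
  D1 a (fun x => F x + H x) y = D1 a F y + D1 a H y.
Proof. by rewrite /D1 addrACA. Qed.

Lemma D2_add r (F H : 'rV['F_2]_r -> 'rV['F_2]_r) a b y :
  D2 a b (fun x => F x + H x) y = D2 a b F y + D2 a b H y.
Proof. by rewrite /D2 !(addrACA _ (F _)). Qed.

(** * Slicing and projecting a subspace *)

Definition lproj m : 'Hom('rV['F_2]_(m + 1), 'rV['F_2]_m) := linfun (@lsubmx _ 1 m 1).
Definition rproj m : 'Hom('rV['F_2]_(m + 1), 'rV['F_2]_1) := linfun (@rsubmx _ 1 m 1).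
Definition slice m (S : {vspace 'rV['F_2]_(m + 1)}) : {vspace 'rV['F_2]_m} :=
  (lproj m @: (S :&: lker (rproj m)))%VS.

Lemma lker_lproj_rproj m : (lker (lproj m) :&: lker (rproj m) = 0)%VS.
Proof.
apply/eqP; rewrite -subv0; apply/subvP => z /memv_capP [].
rewrite !memv_ker !lfunE /= memv0 => /eqP h1 /eqP h2.
by rewrite -[z]hsubmxK h1 h2 row_mx0.
Qed.

Lemma memv_slice m (S : {vspace 'rV['F_2]_(m + 1)}) a :
  (a \in slice _ S) = (row_mx a 0 \in S).
Proof.
apply/memv_imgP/idP => [[z /memv_capP []]|h].
  rewrite memv_ker !lfunE /= => zS /eqP z0 ->.
  by move: zS; rewrite -{1}[z]hsubmxK z0.
exists (row_mx a 0); last by rewrite lfunE /= row_mxKl.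
by rewrite memv_cap h memv_ker lfunE /= row_mxKr eqxx.
Qed.

Lemma dim_slice m (S : {vspace 'rV['F_2]_(m + 1)}) :
  \dim (slice _ S) = \dim (S :&: lker (rproj m)).
Proof.
by apply: limg_dim_eq; rewrite -capvA [(lker _ :&: _)%VS]capvC lker_lproj_rproj capv0.
Qed.

Lemma leq_dim_slice m (S : {vspace 'rV['F_2]_(m + 1)}) :
  (\dim S <= (\dim (slice _ S)).+1)%N.
Proof.
rewrite dim_slice -(limg_ker_dim (rproj m) S) -[X in (_ <= X)%N]addn1.
by rewrite leq_add2l dim_limg1.
Qed.

(** [rproj] is injective on the kernel of [lproj], which is therefore at most a
    line. *)
Lemma leq_dim_lproj m (V : {vspace 'rV['F_2]_(m + 1)}) :
  (\dim V <= (\dim (lproj m @: V)).+1)%N.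
Proof.
rewrite -(limg_ker_dim (lproj m) V) -[X in (_ <= X)%N]add1n leq_add2r.
rewrite -[X in (X <= _)%N](@limg_dim_eq _ _ _ (rproj m)) ?dim_limg1 //.
by rewrite -capvA lker_lproj_rproj capv0.
Qed.

(** If slicing [S] loses a dimension, [S] has some element [(a, 1)]; as the last
    coordinate of [D_(a,1) pi] is constantly 1, projecting [V] then loses none. *)
Lemma leq_dim_slice_lproj m (s1 s2 : 'rV['F_2]_m -> 'rV['F_2]_m)
    (S V : {vspace 'rV['F_2]_(m + 1)}) :
    \dim V = (m + 1 - \dim S)%N ->
    (forall a y v, a \in S -> v \in V -> dotp v (D1 a (pi_map s1 s2) y) = 0) ->
  (m <= \dim (slice _ S) + \dim (lproj m @: V))%N.
Proof.
move=> dimV hV; rewrite -ltnS -[X in (X <= _)%N]addn1.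
have leV: (m + 1 <= \dim V + \dim S)%N.
  by rewrite dimV [X in (_ <= X)%N]addnC -leq_subLR.
apply: (leq_trans leV); case: (boolP (S <= lker (rproj m))%VS) => [sub|].
  by rewrite dim_slice (capv_idPl sub) addnC -addnS leq_add2l leq_dim_lproj.
case/subvPn => a aS; rewrite memv_ker lfunE /= => a1.
have {a1} da: a = row_mx (lsubmx a) e1.
  case: (row_mx_cases _ a) => // da.
  by case/eqP: a1; rewrite da row_mxKr.
rewrite limg_dim_eq; first by rewrite addnC -addSn leq_add2r leq_dim_slice.
apply/eqP; rewrite -subv0; apply/subvP => v /memv_capP [vV].
rewrite memv_ker lfunE /= memv0 => /eqP v0.
case: (row_mx_cases _ v) => dv; first by rewrite dv v0 row_mx0.
(* Now [v = (0, 1)], whose product with [D_(a,1) pi] is 1. *)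
have := hV _ (row_mx 0 0) _ aS vV.
rewrite da dv v0 D1_pi_map_cross dotp_row_mx row_mxKl row_mxKr.
rewrite !dotp_mulmx mul0mx trmx1 mulmx1 !mxE.
by move/eqP.
Qed.

(** * The property (P2) for the glued map *)

(** By [D1_pi_map_cross], the hypothesis describes a constant derivative of [pi]
    in the direction [(a, 1)].  Adding it at [y] and at [y + a] shows that
    [D_a (s1 + s2) = 0]; for [a = 0] this is void, but then [s1 + s2 = c]. *)
Lemma cross_constant_P2 m (s1 s2 : 'rV['F_2]_m -> 'rV['F_2]_m) a c :
  (2 <= m)%N -> (forall y, s2 (y + a) + s1 y = c) -> ~ P2 (fun y => s1 y + s2 y).
Proof.
move=> m2 h hG.
have [b b0 [d hd]]: exists2 b : 'rV['F_2]_m, b != 0 &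
    exists d, forall y, D1 b (fun y => s1 y + s2 y) y = d.
  case: (eqVneq a 0) => [a0|an0]; last first.
    exists a => //; exists 0 => y.
    have := h (y + a); rewrite -[y + a + a]addrA addvv addr0 => h'.
    by rewrite /D1 [s1 (y + a) + _]addrC addrACA h [s1 (y + a) + _]addrC h' addvv.
  exists (const_mx 1); last first.
    have hc y : s1 y + s2 y = c by rewrite addrC -(h y) a0 addr0.
    by exists 0 => y; rewrite /D1 !hc addvv.
  case: m m2 {s1 s2 a c h hG a0} => // m _; apply/eqP => /rowP /(_ 0).
  by rewrite !mxE.
exact: P2_derivative_nonconstant m2 hG b0 hd.
Qed.

Theorem theorem4p2 (m : nat) (sigma1 sigma2 : 'rV['F_2]_m -> 'rV['F_2]_m)
    (hm : (2 <= m)%N)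
    (hsigma1 : bijective sigma1) (hsigma2 : bijective sigma2)
    (hP2 : P2 (fun y : 'rV['F_2]_m => sigma1 y + sigma2 y)) :
  bijective (pi_map sigma1 sigma2) /\ P2 (pi_map sigma1 sigma2).
Proof.
split; first exact: pi_map_bijective.
move=> S [/andP [S_gt0 _] hD2] [V [dimV hV]].
set S0 := slice _ S; set V' := (lproj m @: V)%VS.
have hD2G a b : a \in S0 -> b \in S0 ->
    forall y, D2 a b (fun y => sigma1 y + sigma2 y) y = 0.
  rewrite !memv_slice => aS bS y; rewrite D2_add.
  have := hD2 _ _ aS bS (row_mx y 0); rewrite D2_pi_map0.
  have := hD2 _ _ aS bS (row_mx y e1); rewrite D2_pi_map1.
  move/(congr1 lsubmx); rewrite row_mxKl linear0 => ->.
  by move/(congr1 lsubmx); rewrite row_mxKl linear0 => ->; rewrite addr0.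
have hVG a y v : a \in S0 -> v \in V' ->
    dotp v (D1 a (fun y => sigma1 y + sigma2 y) y) = 0.
  rewrite memv_slice => aS /memv_imgP [w wV ->]; rewrite D1_add dotpDr lfunE /=.
  have := hV _ (row_mx y 0) _ aS wV; have := hV _ (row_mx y e1) _ aS wV.
  by rewrite D1_pi_map0 D1_pi_map1 !dotp_row_mx0 => -> ->; rewrite addr0.
have le_m := leq_dim_slice_lproj _ _ _ _ _ dimV hV.
rewrite -/S0 -/V' in le_m.
(* If the slice is the whole space then [sigma1 + sigma2] is affine,
   with constant derivatives in all directions. *)
have S0_lt: (\dim S0 < m)%N.
  rewrite ltnNge; apply/negP => S0_ge.
  have S0f: S0 = fullv by apply/eqP; rewrite eqEdim subvf dim_rV.
  have b0: const_mx 1 != 0 :> 'rV['F_2]_m.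
    by apply/eqP => /rowP /(_ (Ordinal (ltnW hm))); rewrite !mxE.
  pose c := D1 (const_mx 1) (fun y => sigma1 y + sigma2 y) 0.
  apply: (P2_derivative_nonconstant _ _ _ c hm hP2 b0) => y.
  have := hD2G y (const_mx 1); rewrite S0f !memvf => /(_ isT isT 0).
  rewrite /D2 add0r -addrA => h; apply: addv_eq0.
  by rewrite -[RHS]h /c /D1 add0r !addrA.
case: (posnP (\dim S0)) => [S0_eq0|S0_gt0]; last first.
  have adm: P2_admissible (fun y => sigma1 y + sigma2 y) S0.
    by split; rewrite // S0_gt0 /= subn1 -ltnS prednK // (leq_ltn_trans _ S0_lt).
  by have := P2_dim_lt _ _ _ _ hP2 adm hVG; rewrite ltnNge leq_subLR le_m.
have V'f: V' = fullv.
  by apply/eqP; rewrite eqEdim subvf dim_rV; move: le_m; rewrite S0_eq0.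
(* [S] is nonzero with trivial slice, so it has an element [(a, 1)]. *)
have [a aS]: exists a, row_mx a e1 \in S.
  have: ~~ (S <= lker (rproj m))%VS.
    apply/negP => /capv_idPl h; move: S_gt0.
    by rewrite -{1}h -dim_slice -/S0 S0_eq0.
  case/subvPn => a aS; rewrite memv_ker lfunE /= => a1; exists (lsubmx a).
  case: (row_mx_cases _ a) => [da|<- //].
  by case/eqP: a1; rewrite da row_mxKr.
apply: (cross_constant_P2 _ sigma1 sigma2 a (sigma2 (0 + a) + sigma1 0) hm) hP2 => y.
apply: addv_eq0; apply: dotp_nondegenerate => v.
have: v \in V' by rewrite V'f memvf.
case/memv_imgP => w wV ->; rewrite lfunE /= dotpDr.
have := hV _ (row_mx y 0) _ aS wV; have := hV _ (row_mx 0 0) _ aS wV.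
rewrite !D1_pi_map_cross !dotp_row_mx => h1 h2.
by have /addIr -> := etrans h1 (esym h2); rewrite addF2.
Qed.
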